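(* Let $T$ be a truss, and let $f,g\colon M\to N$ and $h\colon N\to P$ be morphisms of heaps of $T$-modules, with $P\neq\varnothing$. Then the following statements are equivalent: (1) The sequence $M\rightrightarrows N\xrightarrow{h}P$ (with parallel arrows $f,g$) is exact in the sense of Barr. (2) There exists $o\in N$ (and hence for all $o\in N$ the same holds) such that, for $h_o\colon N\times N\to P$ given by $h_o(a,b)=h([a,b,o])=[h(a),h(b),h(o)]$ for all $a,b\in N$, the sequence $$M\xrightarrow{(f,g)}N\times N\xrightarrow{h_o}P$$ is a short exact sequence of heaps of $T$-modules, exact in $N\times N$ at $h(o)$.
   Context: An abelian heap is a (possibly empty) set $H$ with a ternary operation $[-,-,-]$ satisfying $[a,b,[c,d,e]]=[[a,b,c],d,e]$, $[a,b,b]=a=[b,b,a]$ and $[a,b,c]=[c,b,a]$; heap morphisms preserve the bracket. A truss is an abelian heap $T$ with an associative binary multiplication such that $t[s,s',s'']=[ts,ts',ts'']$ and $[s,s',s'']t=[st,s't,s''t]$ (not assumed unital). A left $T$-module is an abelian heap $M$ with an action $\cdot\colon T\times M\to M$ with $t\cdot(t'\cdot m)=(tt')\cdot m$, $[t,t',t'']\cdot m=[t\cdot m,t'\cdot m,t''\cdot m]$, $t\cdot[m,n,e]=[t\cdot m,t\cdot n,t\cdot e]$. A heap of $T$-modules is an abelian heap $M$ (possibly empty) with an operation $T\times M\times M\to M$, $(t,m,n)\mapsto t\triangleright_m n$, such that for each $m\in M$ the map $(t,n)\mapsto t\triangleright_m n$ makes $M$ a left $T$-module, and $t\triangleright_m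 n=[t\triangleright_e n,t\triangleright_e m,m]$ for all $m,n,e\in M$, $t\in T$. Morphisms are heap morphisms $f$ with $f(t\triangleright_m n)=t\triangleright_{f(m)}f(n)$. Products $N\times N$ carry the component-wise structure, and $(f,g)\colon M\to N\times N$ is $m\mapsto(f(m),g(m))$. Exact in the sense of Barr: in the category of heaps of $T$-modules, $(f,g)$ is the kernel pair of $h$ and $h$ is the coequalizer of $(f,g)$. A sequence $A\xrightarrow{u}B\xrightarrow{v}C$ of heaps of $T$-modules is exact in $B$ at $e$ if $e\in v(B)$ and $u(A)=v^{-1}(e)$; it is a short exact sequence if it is exact in $B$ at some $e$, $u$ is injective and $v$ is surjective. *)

(* Defs.v *)
From HB Require Import structures.
From mathcomp Require Import all_boot.
From mathcomp Require Import classical_sets.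

Set Implicit Arguments.
Unset Strict Implicit.
Unset Printing Implicit Defensive.

Local Open Scope classical_set_scope.

(* Carriers are bare types: they may be empty, and no decidable equality or
   choice operator is required. [br a b c] is the heap bracket [a, b, c]. *)
HB.mixin Record isAbHeap H := {
  br : H -> H -> H -> H;
  brA : forall a b c d e, br a b (br c d e) = br (br a b c) d e;
  brKr : forall a b, br a b b = a;
  brKl : forall a b, br b b a = a;
  brC : forall a b c, br a b c = br c b a
}.

#[short(type="abHeapType")]
HB.structure Definition AbHeap := {H of isAbHeap H}.

(* The magma structure [( * )%g] of the library only provides the operation. *)
HB.mixin Record isTruss T of Magma T & AbHeap T := {
  truss_mulA : forall r s t : T, (r * (s * t) = (r * s) * t)%g;
  truss_mul_brr : forall t s s' s'' : T,
    (t * br s s' s'' = br (t * s) (t * s') (t * s''))%g;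
  truss_mul_brl : forall t s s' s'' : T,
    (br s s' s'' * t = br (s * t) (s' * t) (s'' * t))%g
}.

#[short(type="trussType")]
HB.structure Definition Truss := {T of isTruss T & Magma T & AbHeap T}.

Definition left_module_law (T : trussType) (M : abHeapType)
    (act : T -> M -> M) : Prop :=
  [/\ forall t t' m, act t (act t' m) = act (t * t')%g m,
      forall t t' t'' m,
        act (br t t' t'') m = br (act t m) (act t' m) (act t'' m)
    & forall t m n e, act t (br m n e) = br (act t m) (act t n) (act t e)].

(* [hact t m n] is the element usually written t |>_m n. *)
HB.mixin Record isHeapMod (T : trussType) M of AbHeap M := {
  hact : T -> M -> M -> M;
  hact_module : forall m : M, left_module_law (fun t n => hact t m n);
  hact_base : forall t m n e, hact t m n = br (hact t e n) (hact t e m) m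
}.

#[short(type="heapModType")]
HB.structure Definition HeapMod (T : trussType) :=
  {M of isHeapMod T M & AbHeap M}.

Definition heapmod_morphism (T : trussType) (M N : heapModType T)
    (f : M -> N) : Prop :=
  (forall a b c, f (br a b c) = br (f a) (f b) (f c)) /\
  (forall (t : T) m n, f (hact t m n) = hact t (f m) (f n)).

HB.mixin Record isHeapModMorphism (T : trussType) (M N : heapModType T)
    (f : M -> N) := {
  heapmod_morphismP : heapmod_morphism f
}.

HB.structure Definition HeapModMorphism (T : trussType) (M N : heapModType T) :=
  {f of isHeapModMorphism T M N f}.

Notation "{ 'hmod' M -> N }" := (HeapModMorphism.type M N)
  (at level 0, M at level 98, N at level 99,
   format "{ 'hmod'  M  ->  N }") : type_scope.

Section ProductHeap.
Variables M N : abHeapType.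

Definition prod_br (a b c : M * N) : M * N :=
  (br a.1 b.1 c.1, br a.2 b.2 c.2).

Fact prod_brA a b c d e :
  prod_br a b (prod_br c d e) = prod_br (prod_br a b c) d e.
Proof. by rewrite /prod_br /= !brA. Qed.

Fact prod_brKr a b : prod_br a b b = a.
Proof. by case: a => a1 a2; rewrite /prod_br /= !brKr. Qed.

Fact prod_brKl a b : prod_br b b a = a.
Proof. by case: a => a1 a2; rewrite /prod_br /= !brKl. Qed.

Fact prod_brC a b c : prod_br a b c = prod_br c b a.
Proof. by rewrite /prod_br brC [in X in (_, X)]brC. Qed.

HB.instance Definition _ :=
  isAbHeap.Build (M * N)%type prod_brA prod_brKr prod_brKl prod_brC.
End ProductHeap.

Section ProductHeapMod.
Variables (T : trussType) (M N : heapModType T).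

Definition prod_hact (t : T) (m n : M * N) : M * N :=
  (hact t m.1 n.1, hact t m.2 n.2).

Fact prod_hact_module (m : M * N) :
  left_module_law (fun t n => prod_hact t m n).
Proof.
case: m => m1 m2.
have [M1 M2 M3] := @hact_module T M m1; have [N1 N2 N3] := @hact_module T N m2.
by split=> *; rewrite /prod_hact /= ?M1 ?N1 ?M2 ?N2 ?M3 ?N3.
Qed.

Fact prod_hact_base t (m n e : M * N) :
  prod_hact t m n = br (prod_hact t e n) (prod_hact t e m) m.
Proof.
by rewrite /prod_hact (hact_base t m.1 n.1 e.1) (hact_base t m.2 n.2 e.2).
Qed.

HB.instance Definition _ :=
  isHeapMod.Build T (M * N)%type prod_hact_module prod_hact_base.
End ProductHeapMod.

Section Exactness.
Variable T : trussType.

Definition kernel_pair (M N P : heapModType T)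
    (f g : {hmod M -> N}) (h : {hmod N -> P}) : Prop :=
  h \o f =1 h \o g /\
  forall (Q : heapModType T) (p q : {hmod Q -> N}), h \o p =1 h \o q ->
    exists k : {hmod Q -> M},
      (f \o k =1 p /\ g \o k =1 q) /\
      forall k' : {hmod Q -> M}, f \o k' =1 p -> g \o k' =1 q -> k' =1 k.

Definition coequalizer (M N P : heapModType T)
    (f g : {hmod M -> N}) (h : {hmod N -> P}) : Prop :=
  h \o f =1 h \o g /\
  forall (Q : heapModType T) (q : {hmod N -> Q}), q \o f =1 q \o g ->
    exists k : {hmod P -> Q},
      k \o h =1 q /\
      forall k' : {hmod P -> Q}, k' \o h =1 q -> k' =1 k.

Definition barr_exact (M N P : heapModType T)
    (f g : {hmod M -> N}) (h : {hmod N -> P}) : Prop :=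
  kernel_pair f g h /\ coequalizer f g h.

Definition exact_at (A B C : heapModType T) (u : A -> B) (v : B -> C)
    (e : C) : Prop :=
  range v e /\ range u = v @^-1` [set e].

(* [u] and [v] are plain functions, so being morphisms is part of the claim. *)
Definition short_exact_at (A B C : heapModType T) (u : A -> B) (v : B -> C)
    (e : C) : Prop :=
  [/\ heapmod_morphism u, heapmod_morphism v, exact_at u v e,
      injective u & range v = [set: C]].

Definition pair_map (M N : heapModType T) (f g : M -> N) (m : M) : N * N :=
  (f m, g m).

Definition diff_map (N P : heapModType T) (h : N -> P) (o : N) (ab : N * N) : P :=
  h (br ab.1 ab.2 o).

End Exactness.

(* Main.v *)
(** Since [t |>_m m = m], every point of a heap of modules is the image of a
    morphism from the singleton, so that kernel pairs can be tested pointwise: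
    [(f, g)] is the kernel pair of [h] iff it identifies [M] with
    [{(a, b) | h a = h b}], which is the fibre of [h_o] over [h o] for any [o].
    A coequalizer [h] is onto because it factors through its image, and
    conversely a surjective [h] is the coequalizer of its kernel pair. *)
From HB Require Import structures.
Require Import Defs.
From mathcomp Require Import all_boot.
From mathcomp Require Import boolp classical_sets.

Set Implicit Arguments.
Unset Strict Implicit.
Unset Printing Implicit Defensive.

(** * Calculus of nested brackets in abelian heaps *)

Section HeapLaws.
Variable H : abHeapType.
Implicit Types a b c d e : H.

Lemma br_mid a b c d e : br a (br d c b) e = br (br a b c) d e.
Proof.
(* Reading [x] as [d - c + b], the map [br _ d x] undoes the shift by [c - b], which is [brx]. *)
set x := br d c b.
have brx : br (br a b c) d x = a by rewrite -brA [br c d x]brA brKr brKl brKr.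
have <- : br a x d = br a b c by rewrite -{1}brx -brA brKl brKr.
by rewrite -brA brKl.
Qed.

(** Together with [br_swapm], gives the sorting moves on left-nested brackets: terms of equal sign
    may be exchanged. *)
Lemma br_swapr a b c d e : br (br a b c) d e = br (br a b e) d c.
Proof. by rewrite -brA [br c d e]brC brA. Qed.

Lemma br_swapm a b c d e : br (br a b c) d e = br (br a d c) b e.
Proof. by rewrite [br a b c]brC -brA brC br_swapr. Qed.

(* Both sides unfold to alternating sums with positive terms [a1, a3, b2, c1, c3]
   and negative terms [a2, b1, b3, c2]. *)
Lemma br_medial a1 a2 a3 b1 b2 b3 c1 c2 c3 :
  br (br a1 a2 a3) (br b1 b2 b3) (br c1 c2 c3) =
  br (br a1 b1 c1) (br a2 b2 c2) (br a3 b3 c3) :> H.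
Proof.
rewrite !br_mid !brA.
rewrite [br (br _ b3 b2) b1 c1]br_swapr [br (br a1 a2 a3) b3 c1]br_swapr.
rewrite [br (br _ b3 a3) b1 b2]br_swapr.
rewrite [br (br _ b3 b2) b1 a3]br_swapm [br (br a1 a2 c1) b1 b2]br_swapm.
rewrite [br (br _ b3 a3) c2 c3]br_swapm.
by rewrite [br (br _ a2 b2) c2 a3]br_swapm.
Qed.

Lemma br_eqr a b c : br a b c = c -> a = b.
Proof. by move=> abc; rewrite -[LHS](brKr a b) -{2}(brKl b c) brA abc brKl. Qed.

End HeapLaws.

(** * Actions and morphisms of heaps of modules *)

Section HeapModules.
Variable T : trussType.

Lemma hact_id (M : heapModType T) (t : T) (m : M) : hact t m m = m.
Proof. by rewrite (hact_base t m m m) brKl. Qed.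

(** Moving every action to the base [m1] makes it distribute over brackets; the medial law regroups
    the terms so that each base can be moved back. *)
Lemma hact_br (M : heapModType T) (t : T) (m1 m2 m3 n1 n2 n3 : M) :
  hact t (br m1 m2 m3) (br n1 n2 n3) =
  br (hact t m1 n1) (hact t m2 n2) (hact t m3 n3).
Proof.
have [_ _ actD] := hact_module m1.
rewrite (hact_base t _ _ m1) !actD br_medial.
by congr br; rewrite -hact_base.
Qed.

Definition hmod_of (M N : heapModType T) (f : M -> N)
    (fP : heapmod_morphism f) : {hmod M -> N} :=
  HB.pack f (isHeapModMorphism.Build T M N f fP).

Lemma hmod_br (M N : heapModType T) (f : {hmod M -> N}) a b c :
  f (br a b c) = br (f a) (f b) (f c).
Proof. by have [+ _] := @heapmod_morphismP T M N f. Qed.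

Lemma hmod_hact (M N : heapModType T) (f : {hmod M -> N}) t m n :
  f (hact t m n) = hact t (f m) (f n).
Proof. by have [_ +] := @heapmod_morphismP T M N f. Qed.

Lemma id_morphism (M : heapModType T) : heapmod_morphism (@id M).
Proof. by split. Qed.

Lemma comp_morphism (M N P : heapModType T)
    (f : {hmod M -> N}) (g : {hmod N -> P}) : heapmod_morphism (g \o f).
Proof. by split=> *; rewrite /= ?hmod_br ?hmod_hact. Qed.

Lemma cst_morphism (M N : heapModType T) (n : N) :
  heapmod_morphism (fun _ : M => n).
Proof. by split=> *; rewrite ?brKr ?hact_id. Qed.

Lemma pair_map_morphism (M N : heapModType T) (f g : {hmod M -> N}) :
  heapmod_morphism (pair_map f g).
Proof. by split=> *; rewrite /pair_map ?hmod_br ?hmod_hact. Qed.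

(** The constant [o] can be spread over the arguments because [br o o o = o] and
    [hact t o o = o]. *)
Lemma diff_map_morphism (N P : heapModType T) (h : {hmod N -> P}) o :
  heapmod_morphism (diff_map h o).
Proof.
split=> [a b c|t a b]; rewrite /diff_map /=.
  by rewrite -!hmod_br -br_medial brKr.
by rewrite -hmod_hact hact_br hact_id.
Qed.

Lemma diff_mapE (N P : heapModType T) (h : {hmod N -> P}) o a b :
  diff_map h o (a, b) = br (h a) (h b) (h o).
Proof. exact: hmod_br. Qed.

End HeapModules.

(** * The one-point heap of modules *)

Section UnitHeapMod.

Let unit_br (_ _ _ : unit) : unit := tt.

Fact unit_brA a b c d e :
  unit_br a b (unit_br c d e) = unit_br (unit_br a b c) d e.
Proof. by []. Qed.

Fact unit_brKr a b : unit_br a b b = a.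
Proof. by case: a. Qed.

Fact unit_brKl a b : unit_br b b a = a.
Proof. by case: a. Qed.

Fact unit_brC a b c : unit_br a b c = unit_br c b a.
Proof. by []. Qed.

HB.instance Definition _ :=
  isAbHeap.Build unit unit_brA unit_brKr unit_brKl unit_brC.

Variable T : trussType.

(** The vacuous abstraction records [T] in the type, so that each truss has its own copy of [unit]
    to carry the action. *)
Definition point := (fun _ : trussType => unit) T.
HB.instance Definition _ := AbHeap.on point.

Let point_hact (_ : T) (_ _ : point) : point := tt.

Fact point_hact_module (m : point) :
  left_module_law (fun t n => point_hact t m n).
Proof. by split. Qed.

Fact point_hact_base t (m n e : point) :
  point_hact t m n = br (point_hact t e n) (point_hact t e m) m.
Proof. by []. Qed.

HB.instance Definition _ :=
  isHeapMod.Build T point point_hact_module point_hact_base.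

End UnitHeapMod.

(** * The image of a morphism as a heap of modules *)

Section Image.
Variables (T : trussType) (N P : heapModType T) (h : {hmod N -> P}).

Definition image := {p : P | exists n, h n = p}.

Lemma image_inj (x y : image) : sval x = sval y -> x = y.
Proof. by case: x y => [x xP] [y yP] /= xy; apply: eq_exist. Qed.

Let image_br (x y z : image) : image.
Proof.
exists (br (sval x) (sval y) (sval z)).
case: x y z => [_ /= [x <-]] [_ /= [y <-]] [_ /= [z <-]].
by exists (br x y z); rewrite hmod_br.
Defined.

Let image_hact (t : T) (x y : image) : image.
Proof.
exists (hact t (sval x) (sval y)).
by case: x y => [_ /= [x <-]] [_ /= [y <-]]; exists (hact t x y); rewrite hmod_hact.
Defined.

Fact image_brA a b c d e :
  image_br a b (image_br c d e) = image_br (image_br a b c) d e.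
Proof. exact/image_inj/brA. Qed.

Fact image_brKr a b : image_br a b b = a.
Proof. exact/image_inj/brKr. Qed.

Fact image_brKl a b : image_br b b a = a.
Proof. exact/image_inj/brKl. Qed.

Fact image_brC a b c : image_br a b c = image_br c b a.
Proof. exact/image_inj/brC. Qed.

HB.instance Definition _ :=
  isAbHeap.Build image image_brA image_brKr image_brKl image_brC.

Fact image_hact_module (m : image) :
  left_module_law (fun t n => image_hact t m n).
Proof.
have [M1 M2 M3] := hact_module (sval m).
by split=> *; apply: image_inj => /=; rewrite ?M1 ?M2 ?M3.
Qed.

Fact image_hact_base t (m n e : image) :
  image_hact t m n = br (image_hact t e n) (image_hact t e m) m.
Proof. exact/image_inj/hact_base. Qed.

HB.instance Definition _ :=
  isHeapMod.Build T image image_hact_module image_hact_base.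

Lemma image_val_morphism : heapmod_morphism (sval : image -> P).
Proof. by split. Qed.

Definition corestrict (n : N) : image := exist _ (h n) (ex_intro _ n erefl).

Lemma corestrict_morphism : heapmod_morphism corestrict.
Proof.
by split=> *; apply: image_inj; rewrite /= ?hmod_br ?hmod_hact.
Qed.

End Image.

(** * Both notions of exactness in terms of elements *)

Section BarrExact.
Variables (T : trussType) (M N P : heapModType T).
Variables (f g : {hmod M -> N}) (h : {hmod N -> P}).

Lemma kernel_pairP :
  kernel_pair f g h <->
  injective (pair_map f g) /\
  (forall a b, (exists m, pair_map f g m = (a, b)) <-> h a = h b).
Proof.
split=> [[hfg univ]|[inj fgP]].
  split=> [m m' [fm gm]|a b].
    (* The points [m] and [m'] both lift the pair [(f m, g m)] along [(f, g)], so uniqueness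
       identifies them. *)
    have [|k [_ kU]] := univ (point T) (hmod_of (cst_morphism _ (f m)))
      (hmod_of (cst_morphism _ (g m))); first by move=> ?; apply: hfg.
    have := kU (hmod_of (cst_morphism _ m')) (fun=> esym fm) (fun=> esym gm) tt.
    by rewrite -(kU (hmod_of (cst_morphism _ m)) (fun=> erefl) (fun=> erefl)).
  split=> [[m [<- <-]]|hab]; first exact: hfg.
  have [//|k [[fk gk] _]] := univ (point T) (hmod_of (cst_morphism _ a))
    (hmod_of (cst_morphism _ b)).
  by exists (k tt); rewrite /pair_map; have /= -> := fk tt; have /= -> := gk tt.
split=> [m|Q p q hpq]; first by apply/fgP; exists m.
(* Lifts are chosen pointwise; injectivity of [pair_map f g] makes the choice a morphism and the
   only one. *)
have [k kP] := choice (fun x => (fgP (p x) (q x)).2 (hpq x)).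
have kM : heapmod_morphism k.
  have [fgM1 fgM2] := pair_map_morphism f g.
  by split=> *; apply: inj;
     rewrite ?fgM1 ?fgM2 !kP ?hmod_br ?hmod_hact.
exists (hmod_of kM); split.
  by split=> x; have [] := kP x.
move=> k' fk' gk' x; apply: inj; rewrite kP.
by congr pair; [exact: fk'|exact: gk'].
Qed.

Lemma coequalizer_surj :
  coequalizer f g h -> forall p, exists n, h n = p.
Proof.
move=> [hfg univ] p.
have [|k [kh _]] := univ _ (hmod_of (corestrict_morphism h)).
  by move=> m; apply/image_inj/hfg.
(* Both the identity and the inclusion of the image after [k] factor [h] through itself, hence
   agree, so [p] equals the value of [k p] in the image. *)
have [k0 [_ k0U]] := univ _ h hfg.
have kp := k0U (hmod_of (comp_morphism k (hmod_of (image_val_morphism h)))).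
have idp := k0U (hmod_of (id_morphism P)) (fun=> erefl) p.
rewrite /= in kp idp.
case: (svalP (k p)) => n hn; exists n; rewrite hn [RHS]idp -kp// => x /=.
by have /= -> := kh x.
Qed.

Lemma surj_coequalizer :
    (forall p, exists n, h n = p) ->
    (forall a b, (exists m, pair_map f g m = (a, b)) <-> h a = h b) ->
  coequalizer f g h.
Proof.
move=> /choice[s hs] fgP; split=> [m|Q q qfg]; first by apply/fgP; exists m.
have qh a b : h a = h b -> q a = q b by move=> /fgP[m [<- <-]]; apply: qfg.
(* The section [s] need not be a morphism, but [q] only depends on values under [h], where [s]
   cancels. *)
have kM : heapmod_morphism (q \o s).
  by split=> *; rewrite /= -?hmod_br -?hmod_hact; apply: qh;
     rewrite ?hmod_br ?hmod_hact !hs.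
exists (hmod_of kM); split=> [n|k' k'h p] /=; first by apply: qh; rewrite hs.
by rewrite -k'h /= hs.
Qed.

(** The right-hand side does not mention [o]; this is what carries exactness from one base point to
    all others. *)
Lemma short_exact_diffP o :
  short_exact_at (pair_map f g) (diff_map h o) (h o) <->
  [/\ injective (pair_map f g),
      forall a b, (exists m, pair_map f g m = (a, b)) <-> h a = h b
    & forall p, exists n, h n = p].
Proof.
have fib a b : diff_map h o (a, b) = h o <-> h a = h b.
  by rewrite diff_mapE; split=> [/br_eqr|->]; rewrite ?brKl.
split=> [[_ _ [_ rng] inj surj]|[inj fgP surj]].
  split=> // [a b|p].
    rewrite -fib -[_ = h o]/((diff_map h o @^-1` [set h o])%classic (a, b)).
    rewrite -rng.
    by split=> [[m <-]|[m _ <-]]; exists m.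
  have [ab _ <-] : range (diff_map h o) p by rewrite surj.
  by exists (br ab.1 ab.2 o).
split=> //; [exact: pair_map_morphism|exact: diff_map_morphism| |].
  split; first by exists (o, o) => //; rewrite diff_mapE brKl.
  apply/seteqP; split=> [_ [m _ <-]|[a b] /fib/fgP[m <-]] /=; last by exists m.
  by apply/fib/fgP; exists m.
apply/seteqP; split=> // p _; have [n <-] := surj p.
by exists (n, o) => //; rewrite diff_mapE brKr.
Qed.

End BarrExact.

Theorem theorem5p7 (T : trussType) (M N P : heapModType T)
    (f g : {hmod M -> N}) (h : {hmod N -> P}) (P_neq0 : inhabited P) :
  [/\ barr_exact f g h <->
        (exists o : N, short_exact_at (pair_map f g) (diff_map h o) (h o)),
      forall o a b : N, diff_map h o (a, b) = br (h a) (h b) (h o)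
    & (exists o : N, short_exact_at (pair_map f g) (diff_map h o) (h o)) ->
      forall o : N, short_exact_at (pair_map f g) (diff_map h o) (h o)].
Proof.
split; [split|exact: diff_mapE|].
- move=> [/kernel_pairP[inj fgP] /coequalizer_surj surj].
  (* A base point [o] is obtained by lifting a point of the nonempty [P] along the surjection
     [h]. *)
  by have [p] := P_neq0; have [o _] := surj p; exists o; apply/short_exact_diffP.
- move=> [o /short_exact_diffP[inj fgP surj]].
  by split; [apply/kernel_pairP|apply: surj_coequalizer].
- by move=> [o /short_exact_diffP exact_o] o'; apply/short_exact_diffP.
Qed.
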